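(* Every unbreakable 3-cyclic digraph can be made by special edge sums, starting from 3-pinched digraphs. That is, every unbreakable 3-cyclic digraph belongs to the smallest class of digraphs (closed under isomorphism) that contains all 3-pinched digraphs and is closed under taking special edge sums.
   Context: A digraph is a finite directed graph without loops or parallel edges (directed cycles of length two are permitted); $uv$ denotes an edge from $u$ to $v$. A digraph is 3-cyclic if all its directed cycles have length three. For a digraph $G$ (without directed cycles of length two), $G^-$ is the undirected graph with vertex set $V(G)$ in which distinct $u,v$ are adjacent if and only if $uv\in E(G)$ or $vu\in E(G)$. A non-null digraph is strongly connected if for every two vertices $u,v$ there is a directed path from $u$ to $v$; it is weakly 2-connected if $G^-$ is 2-connected (at least three vertices, connected, no cutvertex). $G$ is unbreakable if it is strongly connected and weakly 2-connected. A 3-ring of $G$ is an ordered partition $(A_1,A_2,A_3)$ of $V(G)$ (parts may be empty) such that for every edge $uv$ of $G$ there exists $i\in\{1,2,3\}$ with $u\in A_i$ and $v\in A_{i+1}$ (subscripts modulo 3). $G$ is 3-pinched if it admits a 3-ring $(A_1,A_2,A_3)$ in which some $A_i$ has cardinality one. An edge $uv$ of a digraph is special if either $u$ has outdegree one or $v$ has indegree one. If $uv$ is a special edge of $G$ and $u'v'$ is a special edge of $G'$ (where $G,G'$ are vertex-disjoint), the digraph obtained from $G\cup G'$ by making the identifications $u=u'$ and $v=v'$ (so the two edges $uv$, $u'v'$ become a single edge) is called a special edge sum of $G,G'$. *)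

(* Defs.v *)
From HB Require Import structures.
From mathcomp Require Import all_boot.

Set Implicit Arguments.
Unset Strict Implicit.
Unset Printing Implicit Defensive.

Record digraph := Digraph {
  vertex :> finType;
  edge : rel vertex;
  edge_irr : irreflexive edge }.

Arguments edge {G} : rename.

Definition digraph_iso (G H : digraph) : Prop :=
  exists2 f : G -> H, bijective f & forall x y, edge (f x) (f y) = edge x y.

(* [ucycle] accepts the empty sequence, hence the condition on [c]. *)
Definition three_cyclic (G : digraph) : Prop :=
  forall c : seq G, c != [::] -> ucycle edge c -> size c = 3.

Definition strongly_connected (G : digraph) : Prop :=
  0 < #|G| /\ forall u v : G, connect edge u v.

(* The adjacency relation of the undirected graph G^-. *)
Definition adj (G : digraph) : rel G := [rel u v | edge u v || edge v u].

(* The graph with adjacency relation [e], vertex [w] deleted, has two vertices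
   not joined by a path. *)
Definition cutvertex (T : finType) (e : rel T) (w : T) : Prop :=
  exists x y : T, [/\ x != w, y != w &
    ~~ connect [rel a b | [&& a != w, b != w & e a b]] x y].

Definition two_connected (T : finType) (e : rel T) : Prop :=
  [/\ 3 <= #|T|, (forall x y : T, connect e x y) & forall w : T, ~ cutvertex e w].

Definition weakly_two_connected (G : digraph) : Prop := two_connected (@adj G).

Definition unbreakable (G : digraph) : Prop :=
  strongly_connected G /\ weakly_two_connected G.

(* [ordS] is the cyclic successor on ['I_3]. *)
Definition three_ring (G : digraph) (A : 'I_3 -> {set G}) : Prop :=
  [/\ forall i j, i != j -> [disjoint A i & A j],
      \bigcup_(i < 3) A i = [set: G] &
      forall u v : G, edge u v -> exists i, u \in A i /\ v \in A (ordS i)].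

Definition three_pinched (G : digraph) : Prop :=
  exists2 A : 'I_3 -> {set G}, three_ring A & exists i, #|A i| = 1.

Definition outdegree (G : digraph) (u : G) : nat := #|[set w | edge u w]|.
Definition indegree (G : digraph) (v : G) : nat := #|[set w | edge w v]|.

Definition special (G : digraph) (u v : G) : Prop :=
  edge u v /\ (outdegree u = 1 \/ indegree v = 1).

(* The digraph obtained from the disjoint union of [G] and [G'] by identifying
   [u] with [u'] and [v] with [v'].  Its vertices are those of [G] together with
   those of [G'] other than [u'] and [v']; the quotient map is [inl] on [G] and
   [glue] on [G'], and the edges are the images of the edges of [G] and [G']. *)
Section EdgeSum.
Variables (G G' : digraph) (u v : G) (u' v' : G').

Definition sum_vertex : finType := (G + {x : G' | x \notin [set u'; v']})%type.

Definition glue (x : G') : sum_vertex :=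
  if insub x is Some y then inr y
  else if x == u' then inl u else inl v.

Definition sum_edge : rel sum_vertex := fun p q =>
  [exists x, exists y, [&& edge x y, inl x == p & inl y == q]] ||
  [exists x, exists y, [&& edge x y, glue x == p & glue y == q]].

Hypothesis uv : edge u v.

Lemma glue_inj : injective glue.
Proof.
have nuv : u <> v by move=> E; move: uv; rewrite E edge_irr.
move=> x y; rewrite /glue.
case: insubP => [s _ <-|xuv]; case: insubP => [t _ <-|yuv].
- by case=> ->.
- by case: ifP.
- by case: ifP.
move: xuv yuv; rewrite !inE !negbK => /orP[] /eqP-> /orP[] /eqP->;
  rewrite ?eqxx //; by case: eqP => // _ [] // E; case: nuv; rewrite E.
Qed.

Lemma sum_edge_irr : irreflexive sum_edge.
Proof.
move=> p; apply/negP=> /orP[] /existsP[x /existsP[y /and3P[xy /eqP <- /eqP]]].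
  by case=> E; rewrite E edge_irr in xy.
by move/glue_inj=> E; rewrite E edge_irr in xy.
Qed.

Definition edge_sum : digraph := Digraph sum_edge_irr.

End EdgeSum.

Arguments edge_sum {G G' u v} u' v' uv.

(* The smallest isomorphism-closed class of digraphs that contains the 3-pinched
   digraphs and is closed under special edge sums. *)
Inductive sums_of_three_pinched : digraph -> Prop :=
| Sums_pinched G : three_pinched G -> sums_of_three_pinched G
| Sums_iso G H :
    digraph_iso G H -> sums_of_three_pinched G -> sums_of_three_pinched H
| Sums_edge_sum (G G' : digraph) (u v : G) (u' v' : G') (uv : edge u v) :
    special u v -> special u' v' ->
    sums_of_three_pinched G -> sums_of_three_pinched G' ->
    sums_of_three_pinched (edge_sum u' v' uv).

(* Main.v *)
Require Import Defs.
From mathcomp Require Import all_boot.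

(** If a set [X] of vertices is left by a single edge [yx], then every edge
    entering [X] lies in a triangle through [yx], hence starts at [x] or ends
    at [y].  So when [X] and its complement both have at least two vertices,
    [G] is the special edge sum along [yx] of the digraphs induced on
    [X + x] and [~X + y]; both are again unbreakable and 3-cyclic.

    It remains to see that without such a cut some vertex meets all cycles, as
    [G] is then 3-pinched.  If [v] meets not all cycles, take a nontrivial strong
    component [C] of [G \ v].  A path leaving [C] at [p] and returning at
    [q <> p] has length two, since it is closed up by a path inside [C]; this
    produces a cut as above unless [C = G \ v].  Hence all [G \ v] are strong,
    all in- and outdegrees are at least two, and every outneighbour [q] of [v]
    is joined to every inneighbour [p] by an edge [qp]; a path from [p1] to [q1]
    of length two then gives a cycle [v q2 p1 z q1 p2] of length six. *)

Set Implicit Arguments.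
Unset Strict Implicit.
Unset Printing Implicit Defensive.

(** * Relations, paths and short cycles *)

Definition within (T : finType) (A : pred T) (e : rel T) : rel T :=
  fun a b => [&& A a, A b & e a b].
Arguments within {T} A e a b /.

Definition symmetrized (T : finType) (e : rel T) : rel T :=
  fun u v => e u v || e v u.
Arguments symmetrized {T} e u v /.

Definition reversed (T : finType) (e : rel T) : rel T :=
  fun u v => e v u.
Arguments reversed {T} e u v /.

Definition all_cycles_3 (T : finType) (e : rel T) : Prop :=
  forall c : seq T, c != [::] -> ucycle e c -> size c = 3.

(** Bare relations make reversal and restriction to subtypes immediate; [u3_cyc] excludes loops,
    which are cycles of length one. *)
Record unbreakable3 (T : finType) (e : rel T) : Prop := Unbreakable3 {
  u3_strong : forall x y, connect e x y;
  u3_cyc : all_cycles_3 e;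
  u3_conn : two_connected (symmetrized e) }.

(** The last two fields ensure that [x |: X] and [y |: ~: X] are both proper subsets. *)
Record one_edge_cut (T : finType) (e : rel T) (X : {set T}) (y x : T) : Prop :=
  OneEdgeCut {
  cut_in : y \in X;
  cut_out : x \notin X;
  cut_edge : e y x;
  cut_only : forall a b, a \in X -> b \notin X -> e a b -> a = y /\ b = x;
  cut_left : exists2 a, a \in X & a != y;
  cut_right : exists2 b, b \notin X & b != x }.

(** An edge may go to a path, even a trivial one, so that [f] can be a contraction. *)
Lemma connect_mono (T U : finType) (e : rel T) (d : rel U) (f : T -> U) :
  (forall a b, e a b -> connect d (f a) (f b)) ->
  forall a b, connect e a b -> connect d (f a) (f b).
Proof.
move=> ed a b /connectP[s ps ->]; elim: s a ps => [|c s IH] a /= => [_|].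
  exact: connect0.
by case/andP=> /ed ac /IH; apply: connect_trans.
Qed.

Lemma connect_exit (T : finType) (e : rel T) (A : {pred T}) x y :
  connect e x y -> x \in A -> y \notin A ->
  exists a b, [/\ a \in A, b \notin A & e a b].
Proof.
case/connectP=> s ps ->; elim: s x ps => [|c s IH] x /=; first by move=> _ ->.
case/andP=> xc ps xA; case: (boolP (c \in A)) => cA; first exact: IH.
by exists x, c.
Qed.

Lemma within_reversed (T : finType) (A : pred T) (e : rel T) x y :
  connect (within A (reversed e)) x y = connect (within A e) y x.
Proof.
rewrite -[RHS](connect_rev (within A e)); apply: eq_connect => a b.
by rewrite /within /= andbCA.
Qed.

Lemma connect_reversed (T : finType) (e : rel T) x y :
  connect (reversed e) x y = connect e y x.
Proof. exact: connect_rev. Qed.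

Lemma within_path (T : finType) (A : pred T) (e : rel T) x y :
  connect (within A e) x y -> A x ->
  exists s, [/\ path e x s, last x s = y, uniq (x :: s) & all A (x :: s)].
Proof.
move=> /connectP[s0 ps0 ->] Ax; case/shortenP: ps0 => s ps us _.
exists s; split=> //; last first.
  rewrite /= Ax /=; elim: s x ps {us Ax} => //= c s IH x /andP[/and3P[_ -> _]].
  exact: IH.
by apply: sub_path ps => a b /and3P[].
Qed.

(** The sequences omit the first vertex of each path, so [s1 ++ s2] lists every vertex of the closed
    walk once. *)
Lemma two_paths_size (T : finType) (e : rel T) x y s1 s2 :
  all_cycles_3 e -> path e y s1 -> last y s1 = x -> path e x s2 ->
  last x s2 = y -> uniq (s1 ++ s2) -> s2 != [::] -> size s1 + size s2 = 3.
Proof.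
move=> cyc p1 l1 p2 l2 us n2; rewrite -size_cat; apply: cyc.
  by case: s1 s2 n2 {p1 l1 p2 l2 us} => [|? ?] [|? ?].
rewrite /ucycle us andbT (cycle_path y) last_cat l1 l2 cat_path p1 l1.
exact: p2.
Qed.

Lemma no_2cycle (T : finType) (e : rel T) x y :
  all_cycles_3 e -> e x y -> e y x -> False.
Proof.
move=> cyc xy yx; have [E|xny] := eqVneq x y.
  by have := cyc [:: x] isT; rewrite /ucycle /= {2}E xy => /(_ isT).
have := cyc [:: x; y] isT; rewrite /ucycle /= xy yx inE xny.
by move/(_ isT).
Qed.

Lemma edge_neq (T : finType) (e : rel T) x y :
  all_cycles_3 e -> e x y -> x != y.
Proof. by move=> cyc xy; apply/eqP=> E; subst y; exact: (no_2cycle cyc xy xy). Qed.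

(** A simple path from [b] to [a] inside [A] closes up with [ab] to a cycle, so it has length
    two. *)
Lemma triangle_within (T : finType) (A : pred T) (e : rel T) a b :
  all_cycles_3 e -> e a b -> A b -> connect (within A e) b a ->
  exists c, [/\ A c, e b c & e c a].
Proof.
move=> cyc ab Ab cba; have [s [ps ls us As]] := within_path cba Ab.
have sz: size s + size [:: b] = 3.
  apply: two_paths_size ps ls _ _ _ _ => //=; first by rewrite ab.
  by rewrite cats1 rcons_uniq.
rewrite addn1 in sz; case: s ps ls As sz {us} => [|c [|d [|? ?]]] //=.
by move=> /and3P[bc cd _] E /and3P[_ Ac _] _; exists c; rewrite -E.
Qed.

Lemma edge_in_triangle (T : finType) (e : rel T) a b :
  unbreakable3 e -> e a b -> exists2 c, e b c & e c a.
Proof.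
case=> str cyc _ ab; have /(triangle_within cyc ab isT)[c [_ bc ca]] :
    connect (within xpredT e) b a.
  by apply: (@connect_mono _ _ e _ id) (str b a) => u w uw; apply: connect1.
by exists c.
Qed.

(** A simple path inside [C] from [q] to [p] and an ear from [p] to [q] through the outside form a
    cycle. The ear has at least two edges and, as [p != q], the inner path at least one; total
    length three forces equality in both. *)
Lemma open_ear (T : finType) (e : rel T) (C : {set T}) p q w z :
  all_cycles_3 e -> p \in C -> q \in C -> p != q ->
  connect (within (mem C) e) q p -> e p w -> e z q -> w \notin C ->
  connect (within (predC (mem C)) e) w z -> w = z /\ e q p.
Proof.
move=> cyc pC qC pq cqp pw zq wC cwz.
have [s1 [p1 l1 u1 a1]] := within_path cqp qC.
have [s2 [p2 l2 u2 a2]] := within_path cwz wC.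
have sz: size s1 + size (rcons (w :: s2) q) = 3.
  apply: two_paths_size p1 l1 _ _ _ _ => //.
  - by rewrite rcons_path /= pw p2 l2.
  - by rewrite last_rcons.
  move: u1; rewrite cons_uniq => /andP[q1 u1].
  have qs2: q \notin w :: s2.
    by apply/negP=> /(allP a2) /=; rewrite qC.
  rewrite cat_uniq u1 rcons_uniq qs2 u2 !andbT -all_predC.
  apply/allP=> u; rewrite mem_rcons inE => /orP[/eqP->//|/(allP a2) /= uC].
  by apply: contra uC => us; apply: (allP a1); rewrite inE us orbT.
case: s1 p1 l1 sz {u1 a1} => [_ E|a [|? ?]]; first by rewrite -E eqxx in pq.
  rewrite /= andbT => qa <-; rewrite size_rcons.
  by case: s2 p2 l2 {u2 a2} => // _ /= -> _; rewrite qa.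
by rewrite size_rcons /= !addnS.
Qed.

(** * Reversal of all edges *)

Lemma symmetrized_reversed (T : finType) (e : rel T) :
  symmetrized (reversed e) =2 symmetrized e.
Proof. by move=> x y; exact: orbC. Qed.

Lemma unbreakable3_reversed (T : finType) (e : rel T) :
  unbreakable3 e -> unbreakable3 (reversed e).
Proof.
case=> str cyc [c3 con cut]; split.
- by move=> x y; rewrite connect_reversed.
- move=> c c0 /andP[cy us]; rewrite -size_rev; apply: cyc.
    by rewrite -size_eq0 size_rev size_eq0.
  by rewrite /ucycle rev_uniq us rev_cycle andbT.
- split=> // [x y|w [x [y [xw yw nc]]]].
    by rewrite (eq_connect (symmetrized_reversed e)).
  case: (cut w); exists x, y; split=> //; apply: contra nc.
  rewrite (@eq_connect _ _ [rel a b | [&& a != w, b != w & symmetrized e a b]]) //.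
  by move=> a b; rewrite /= [e b a || _]orbC.
Qed.

Lemma one_edge_cut_reversed (T : finType) (e : rel T) X y x :
  one_edge_cut e X y x -> one_edge_cut (reversed e) (~: X) x y.
Proof.
case=> yX xX yx only [a aX ay] [b bX bx]; split; rewrite ?inE ?negbK //.
- by move=> u w; rewrite !inE negbK => uX wX /= /(only _ _ wX uX)[].
- by exists b; rewrite ?inE.
- by exists a; rewrite ?inE ?negbK.
Qed.

(** * One-edge cuts from a component of a vertex deletion *)

Lemma deletion_connected (T : finType) (e : rel T) w x y :
  two_connected e -> x != w -> y != w -> connect (within (predC1 w) e) x y.
Proof.
case=> _ _ cut xw yw; apply/negPn/negP => nc; apply: (cut w).
by exists x, y; split.
Qed.

(* What is used of a nontrivial strong component of [G \ v]; the conditions are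
   invariant under reversing all edges. *)
Record deletion_component (T : finType) (e : rel T) (v : T) (C : {set T}) :
  Prop := DeletionComponent {
  dc_out : v \notin C;
  dc_strong : forall a b, a \in C -> b \in C -> connect (within (mem C) e) a b;
  dc_ear : forall p w z q, p \in C -> w \notin C -> e p w -> z \notin C ->
    q \in C -> e z q -> connect (within (predC (mem C)) e) w z;
  dc_max : forall p w q, p \in C -> w \notin C -> q \in C -> e p w -> e w q ->
    w = v;
  dc_nontrivial : exists a b, [/\ a \in C, b \in C & a != b] }.

Lemma deletion_component_reversed (T : finType) (e : rel T) v C :
  deletion_component e v C -> deletion_component (reversed e) v C.
Proof.
case=> vC str ear mx ntr; split=> //.
- by move=> a b aC bC; rewrite within_reversed; exact: str.
- move=> p w z q pC wC pw zC qC zq; rewrite within_reversed.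
  exact: (ear q z w p).
- by move=> p w q pC wC qC pw wq; exact: (mx q w p).
Qed.

(** By [open_ear] and [dc_max], an exit and an entry at different vertices of [C] share their outer
    end, which is [v]. As [z != v], all exits start at [c]; an entry away from [c] then forces them
    to end at [v]. *)
Lemma component_entry_cut (T : finType) (e : rel T) v C z c :
  unbreakable3 e -> deletion_component e v C ->
  z \notin C -> c \in C -> e z c -> z != v -> one_edge_cut e C c v.
Proof.
move=> [str cyc two] [vC cstr ear mx [c1 [c2 [c1C c2C c12]]]] zC cC zc zv.
have exits p w : p \in C -> w \notin C -> e p w -> p = c.
  move=> pC wC pw; apply/eqP/negPn/negP => pc.
  have [E _] := open_ear cyc pC cC pc (cstr _ _ cC pC) pw zc wC
    (ear _ _ _ _ pC wC pw zC cC zc).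
  by move: zv; rewrite (mx p z c) ?eqxx // -E.
have [d dC dc] : exists2 d, d \in C & d != c.
  have [E|c1c] := eqVneq c1 c; last by exists c1.
  by exists c2; rewrite // -E eq_sym.
have vc : v != c by apply: contraNneq vC => ->.
(* With [c] deleted, [d] is still joined to [v]. The edge between [C] and the outside found on the
   way cannot leave [C], so it enters at some [q != c]. *)
have [q [z' [qC z'C /and3P[qc z'c /orP[]]]]] :=
  connect_exit (deletion_connected two dc vc) dC vC.
  by move=> /(exits _ _ qC z'C) E; rewrite /= E eqxx in qc.
move=> z'q.
have cutE p w : p \in C -> w \notin C -> e p w -> p = c /\ w = v.
  move=> pC wC pw; have E := exits _ _ pC wC pw; split=> //; subst p.
  have cq : c != q by rewrite eq_sym.
  have [E _] := open_ear cyc pC qC cq (cstr _ _ qC pC) pw z'q wC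
    (ear _ _ _ _ pC wC pw z'C qC z'q).
  by subst w; exact: mx pw z'q.
(* Some edge does leave [C], so [cv] is an edge. *)
have [a [b [aC bC ab]]] := connect_exit (str c z) cC zC.
have [Ea Eb] := cutE _ _ aC bC ab; subst a b.
by split=> //; [exists d | exists z].
Qed.

(** With [v] deleted, some edge still joins [C] to its outside; if it leaves [C], reversal turns it
    into an entering one. *)
Lemma component_cut (T : finType) (e : rel T) v C z :
  unbreakable3 e -> deletion_component e v C -> z \notin C -> z != v ->
  exists X y x, one_edge_cut e X y x.
Proof.
move=> ub dc zC zv.
have [c [d [cC _ _]]] := dc_nontrivial dc.
have cv : c != v by apply: contraNneq (dc_out dc) => <-.
have [a [b [aC bC /and3P[/= av bv /orP[]]]]] :=
  connect_exit (deletion_connected (u3_conn ub) cv zv) cC zC => [ab|ba].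
  have := component_entry_cut (unbreakable3_reversed ub)
    (deletion_component_reversed dc) bC aC ab bv.
  by move/one_edge_cut_reversed; exists (~: C), v, a.
by exists C, a, v; exact: component_entry_cut ub dc bC aC ba bv.
Qed.

(** * Strong components of a vertex deletion *)

Definition component (T : finType) (e : rel T) (v c0 : T) : {set T} :=
  [set x | connect (within (predC1 v) e) c0 x
        && connect (within (predC1 v) e) x c0].

Lemma component_reversed (T : finType) (e : rel T) v c0 :
  component (reversed e) v c0 = component e v c0.
Proof. by apply/setP=> x; rewrite !inE !(within_reversed _ e) andbC. Qed.

Lemma connect_within (T : finType) (A : pred T) (e : rel T) x y :
  connect (within A e) x y -> A x -> A y.
Proof.
move=> cxy Ax; have [s [_ <- _ /allP]] := within_path cxy Ax.
by apply; exact: mem_last.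
Qed.

(** Up to its first visit to [v], a path from [w] stays outside [C]: a vertex reachable from [c0] in
    [G \ v] but not in [C] cannot reach [c0] there. *)
Lemma component_exit (T : finType) (e : rel T) v c0 p w :
  connect e w v -> c0 != v -> p \in component e v c0 ->
  w \notin component e v c0 -> e p w ->
  connect (within (predC (mem (component e v c0))) e) w v.
Proof.
move=> cwv c0v; rewrite [p \in _]inE => /andP[c0p pc0] wC pw.
set C := component e v c0 in wC *.
have vC : v \notin C.
  by rewrite inE; apply/nandP; left; apply/negP => /connect_within /(_ c0v); rewrite /= eqxx.
have pv : p != v := connect_within c0p c0v.
have [->|wv] := eqVneq w v; first exact: connect0.
have c0w : connect (within (predC1 v) e) c0 w.
  by apply: connect_trans c0p (connect1 _); rewrite /= pv wv.
case/connectP: cwv => s ps lv; clear p c0p pc0 pw pv.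
elim: s w ps lv wC wv c0w => [|w1 s IH] w /=; first by move=> _ ->; rewrite eqxx.
case/andP=> ww1 ps lv wC wv c0w.
have [E|w1v] := eqVneq w1 v.
  by apply: connect1; rewrite /= wC -E ww1 E vC.
have cw1 : connect (within (predC1 v) e) w w1.
  by apply: connect1; rewrite /= wv w1v.
have w1C : w1 \notin C.
  apply: contra wC; rewrite !inE c0w => /andP[_ /=]; exact: connect_trans.
apply: connect_trans (connect1 _) (IH w1 ps lv w1C w1v _).
  by rewrite /= wC w1C.
exact: connect_trans c0w cw1.
Qed.

Lemma componentP (T : finType) (e : rel T) v c0 c1 :
  unbreakable3 e -> c0 != v -> c1 != v -> e c0 c1 ->
  connect (within (predC1 v) e) c1 c0 ->
  deletion_component e v (component e v c0).
Proof.
move=> ub c0v c1v c01 c10; have [str cyc _] := ub.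
have Cv x : x \in component e v c0 -> x != v.
  by rewrite inE => /andP[/connect_within /(_ c0v)].
split.
- by apply/negP=> /Cv; rewrite eqxx.
- move=> a b aC bC; have: connect (within (predC1 v) e) a b.
    move: aC bC; rewrite !inE => /andP[_ ac] /andP[cb _].
    exact: connect_trans ac cb.
  (* A path of [G \ v] between two vertices of the component stays inside it. *)
  case/connectP=> s ps lb; move: bC; rewrite {b}lb.
  elim: s a aC ps => [|d s IH] a aC /=; first by move=> *; exact: connect0.
  case/andP=> ad ps lC.
  have cad : connect (within (predC1 v) e) a d by exact: connect1.
  have dC : d \in component e v c0.
    rewrite inE; move: aC; rewrite inE => /andP[ca _].
    rewrite (connect_trans ca cad) /=.
    move: lC; rewrite inE => /andP[_]; apply: connect_trans.
    by apply/connectP; exists s.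
  apply: connect_trans (connect1 _) (IH d dC ps lC).
  by rewrite /= aC dC; case/and3P: ad.
- move=> p w z q pC wC pw zC qC zq.
  (* The two halves meet at [v]: one runs from [w] to [v], the other, obtained by reversal, from [v]
     to [z]. *)
  apply: connect_trans (component_exit (str w v) c0v pC wC pw) _.
  have E := component_reversed e v c0; rewrite -within_reversed -{1}E.
  apply: (@component_exit _ (reversed e) v c0 q); rewrite ?E //.
  by rewrite (connect_reversed e).
- move=> p w q pC wC qC pw wq; apply/eqP; apply: contraNT wC => wv.
  have [pv qv] := (Cv _ pC, Cv _ qC).
  move: pC qC; rewrite !inE => /andP[c0p _] /andP[_ qc0].
  rewrite (connect_trans c0p) ?(connect_trans _ qc0) //; apply: connect1;
    by rewrite /= ?pv ?wv ?qv.
- exists c0, c1; split; last exact: edge_neq cyc c01.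
    by rewrite inE connect0.
  by rewrite inE c10 andbT connect1 //= c0v c1v.
Qed.

(** * The case that all vertex deletions are strong *)

(** With [p] deleted, a third vertex still reaches [v], so [v] keeps an inneighbour. *)
Lemma strong_deletion_degree (T : finType) (e : rel T) v p :
  unbreakable3 e ->
  (forall w a b, a != w -> b != w -> connect (within (predC1 w) e) a b) ->
  e p v -> exists2 p', e p' v & p' != p.
Proof.
move=> [str cyc [c3 _ _]] sd pv.
have vp : v != p by rewrite eq_sym (edge_neq cyc pv).
have [u up uv] : exists2 u, u != p & u != v.
  have: 0 < #|~: [set p; v]|.
    by rewrite cardsCs setCK cards2 subn_gt0 (leq_trans _ c3) // ltnS; case: (_ != _).
  by case/card_gt0P=> u; rewrite !inE negb_or => /andP[up uv]; exists u.
have := connect_exit (A := predC1 v) (sd p _ _ up vp) uv.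
rewrite !inE eqxx => /(_ isT) [a [b [_ bv /and3P[ap _ ab]]]].
by exists a; rewrite // -(eqP (negbNE bv)).
Qed.

Lemma not_all_deletions_strong (T : finType) (e : rel T) :
  unbreakable3 e ->
  ~ (forall w a b, a != w -> b != w -> connect (within (predC1 w) e) a b).
Proof.
move=> ub sd; have [str cyc [c3 _ _]] := ub.
have /card_gt1P[v [v0 [_ _ vv0]]] : 1 < #|T| by exact: leq_trans c3.
have [_ [q1 [/eqP-> _ vq1]]] : exists a b, [/\ a \in pred1 v, b \notin pred1 v & e a b].
  by apply: connect_exit (str v v0) _ _; rewrite inE // eq_sym.
have [p1 _ p1v] := edge_in_triangle ub vq1.
have [p2 p2v p21] := strong_deletion_degree ub sd p1v.
have sd' w a b : a != w -> b != w -> connect (within (predC1 w) (reversed e)) a b.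
  by move=> aw bw; rewrite within_reversed; exact: sd.
have [q2 vq2 q21] := strong_deletion_degree (unbreakable3_reversed ub) sd' vq1.
rewrite /reversed /= in vq2.
(* Here [open_ear] is applied to the set of all vertices but [v], with ear [p v q]. *)
have qp p q : e p v -> e v q -> e q p.
  move=> pv vq; have pq : p != q.
    by apply/eqP=> E; subst q; exact: (no_2cycle cyc pv vq).
  have pnv := edge_neq cyc pv.
  have qnv : q != v by rewrite eq_sym; exact: edge_neq cyc vq.
  have [] // := @open_ear _ e (~: [set v]) p q v v cyc _ _ pq _ pv vq; rewrite ?inE ?eqxx //.
  rewrite (@eq_connect _ _ (within (predC1 v) e)) ?sd // => a b.
  by rewrite /within /= !inE.
have nv x y : e x y -> x != y := edge_neq cyc.
have n2 x y z : e x y -> e y z -> x != z.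
  by move=> xy yz; apply/eqP=> E; subst z; exact: (no_2cycle cyc xy yz).
have q1v : q1 != v by rewrite eq_sym nv.
(* The edge [q1 p1] lies in a triangle avoiding [v], since [G \ v] is strong. *)
have [z [/= zv p1z zq1]] :=
  triangle_within cyc (qp _ _ p1v vq1) (nv _ _ p1v) (sd _ _ _ (nv _ _ p1v) q1v).
have q2p1 := qp _ _ p1v vq2; have q1p2 := qp _ _ p2v vq1.
(* The opposite pairs [v, z], [q2, q1] and [p1, p2] are distinct by choice, all other pairs because
   there are no loops or 2-cycles. *)
have := cyc [:: v; q2; p1; z; q1; p2] isT.
rewrite /ucycle /= vq2 q2p1 p1z zq1 q1p2 p2v /= !inE !negb_or.
rewrite !(nv _ _ vq2, nv _ _ q2p1, nv _ _ p1z, nv _ _ zq1, nv _ _ q1p2, nv _ _ vq1).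
rewrite (n2 _ _ _ vq2 q2p1) (n2 _ _ _ zq1 q1p2) (n2 _ _ _ q2p1 p1z) (n2 _ _ _ p1z zq1).
rewrite q21 (eq_sym p1) p21 (eq_sym v p2) (nv _ _ p2v) (nv _ _ (qp _ _ p2v vq2)).
by rewrite (eq_sym v z) zv => /(_ isT).
Qed.

(** The second alternative says that [G \ v] has no directed cycle. *)
Lemma one_edge_cut_or_dominating_vertex (T : finType) (e : rel T) :
  unbreakable3 e ->
  (exists X y x, one_edge_cut e X y x) \/
  exists v, forall a b, a != v -> b != v -> e a b ->
    ~~ connect (within (predC1 v) e) b a.
Proof.
move=> ub.
case: (boolP [exists v, forall a, forall b,
  [==> a != v, b != v, e a b => ~~ connect (within (predC1 v) e) b a]]).
  case/existsP=> v /forallP H; right; exists v => a b av bv ab.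
  by move: (H a) => /forallP/(_ b); rewrite av bv ab.
move=> /existsPn cyc.
case: (boolP [forall w, forall a, forall b,
  [==> a != w, b != w => connect (within (predC1 w) e) a b]]) => [/forallP H|].
  case: (not_all_deletions_strong ub) => w a b aw bw.
  by move: (H w) => /forallP/(_ a)/forallP/(_ b); rewrite aw bw.
(* Choosing [v] with [G \ v] not strong excludes a component that fills all of [G \ v]. *)
case/forallPn=> v nsd; left.
have /forallPn[c0 /forallPn[c1]] := cyc v.
rewrite !negb_imply andbT => /and4P[c0v c1v c01 c10].
have dc := componentP ub c0v c1v c01 c10.
case: (boolP [exists z, (z \notin component e v c0) && (z != v)]).
  by case/existsP=> z /andP[zC zv]; exact: component_cut ub dc zC zv.
move/existsPn=> all_in; case/negP: nsd.
apply/forallP=> a; apply/forallP=> b; apply/implyP=> av; apply/implyP=> bv.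
have inC z : z != v -> z \in component e v c0.
  by move=> zv; move: (all_in z); rewrite zv andbT negbK.
apply: connect_sub (dc_strong dc (inC _ av) (inC _ bv)) => x y /and3P[xC yC xy].
apply: connect1; rewrite /= xy andbT.
by apply/andP; split; apply: contraNneq (dc_out dc) => E; rewrite -{1}E.
Qed.

(** * The two sides of a one-edge cut *)

(** The triangle through [ab] has to leave [X] along [yx], just before or just after its third
    vertex. *)
Lemma cut_entry (T : finType) (e : rel T) X y x a b :
  unbreakable3 e -> one_edge_cut e X y x ->
  a \notin X -> b \in X -> e a b -> a = x \/ b = y.
Proof.
move=> ub [_ _ _ only _ _] aX bX ab; have [c bc ca] := edge_in_triangle ub ab.
by case: (boolP (c \in X)) => cX; [left; case: (only c a) | right; case: (only b c)].
Qed.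

(** A triangle through [yx] could have its third vertex outside [X]. With [y] deleted, however, [X]
    is still joined to [x], and the edge responsible must enter [X] from [x]; its head is the vertex
    sought. *)
Lemma cut_return (T : finType) (e : rel T) X y x :
  unbreakable3 e -> one_edge_cut e X y x ->
  exists w, [/\ w \in X, e x w & e w y].
Proof.
move=> ub cutX; have [yX xX yx only [a aX ay] _] := cutX.
have [_ cyc two] := ub.
have xy : x != y by apply: contraNneq xX => ->.
have [u [w [uX wX /and3P[uy wy uw]]]] :=
  connect_exit (deletion_connected two ay xy) aX xX.
have wu : e w u.
  by case/orP: uw => // /(only _ _ uX wX)[E _]; rewrite /= E eqxx in uy.
have [E|E] := cut_entry ub cutX wX uX wu; last by rewrite /= E eqxx in uy.
(* An edge [uc] leaving [X] would start at [y], so [c] is in [X] and [cx] is the cut edge. *)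
subst w; exists u; split=> //; have [c uc cx] := edge_in_triangle ub wu.
case: (boolP (c \in X)) => cX; first by have [<- _] := only _ _ cX xX cx.
by have [E _] := only _ _ uX cX uc; rewrite /= E eqxx in uy.
Qed.

(** Paths of the whole digraph are carried into the side by contracting the outside to one vertex;
    [leave] and [enter] control the edges affected. *)
Lemma side_unbreakable (T : finType) (e : rel T) X y x :
  unbreakable3 e -> one_edge_cut e X y x ->
  unbreakable3 (relpre (val : {z | z \in x |: X} -> T) e).
Proof.
move=> ub cutX; have [yX xX yx only [a0 a0X a0y] _] := cutX.
have [str cyc two] := ub.
have xW : x \in x |: X by exact: setU11.
have yW : y \in x |: X by rewrite setU1r.
pose U : finType := {z | z \in x |: X}; pose x1 : U := Sub x xW; pose y1 : U := Sub y yW.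
have outE (d : U) z : z \notin x |: X -> insubd d z = d.
  by move=> zW; rewrite /insubd insubN.
have leave a b : a \in x |: X -> b \notin x |: X -> e a b -> a = x.
  rewrite !inE negb_or => /orP[/eqP//|aX] /andP[bx bX] /(only _ _ aX bX)[_ E].
  by rewrite E eqxx in bx.
have enter a b : a \notin x |: X -> b \in x |: X -> e a b -> b = x \/ b = y.
  rewrite !inE negb_or => /andP[ax aX] /orP[/eqP|bX ab]; first by left.
  by have [E|] := cut_entry ub cutX aX bX ab; [rewrite E eqxx in ax | right].
have str1 (u w : U) : connect (relpre val e) u w.
  (* Everything outside the side is contracted to [x]. *)
  rewrite -(valKd x1 u) -(valKd x1 w).
  apply: (@connect_mono _ _ e _ (insubd x1)) (str _ _) => a b ab.
  case: (boolP (a \in x |: X)) => aW; case: (boolP (b \in x |: X)) => bW.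
  - by apply: connect1; rewrite /= !insubdK.
  - rewrite (outE x1 b bW) (leave _ _ aW bW ab).
    by rewrite (_ : insubd x1 x = x1) //; apply: val_inj; rewrite insubdK.
  (* An edge entering at [y] would become [xy], the reverse of the cut edge; the path [x c y]
     replaces it. *)
  - rewrite (outE x1 a aW); have [c [cX xc cy]] := cut_return ub cutX.
    have [->|->] := enter _ _ aW bW ab.
      by rewrite (_ : insubd x1 x = x1) //; apply: val_inj; rewrite insubdK.
    have cW : c \in x |: X by rewrite setU1r.
    apply: (@connect_trans _ _ (Sub c cW)); apply: connect1 => //=.
    by rewrite insubdK.
  - by rewrite !outE.
split=> //.
  move=> c c0 /andP[cy us]; rewrite -(size_map val); apply: cyc.
    by case: c c0 {cy us}.
  by rewrite /ucycle map_inj_uniq ?us ?andbT ?cycle_map //; exact: val_inj.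
split.
- rewrite card_sig (eq_card (B := mem (x |: X))) // cardsU1 xX ltnS.
  by apply/card_gt1P; exists a0, y.
- move=> u w; apply: connect_sub (str1 u w) => a b ab.
  by apply: connect1; rewrite /= [e _ _]ab.
move=> w [u1 [u2 [u1w u2w /negP[]]]].
(* Here the outside is contracted to whichever of [x], [y] is not deleted. *)
pose d := if w == x1 then y1 else x1.
have dw : d != w.
  rewrite /d; case: (w =P x1) => [->|/eqP]; last by rewrite eq_sym.
  by rewrite -val_eqE /=; apply: contraNneq xX => <-.
have pw a : a != val w -> insubd d a != w.
  move=> aw; case: (boolP (a \in x |: X)) => aW; last by rewrite outE.
  by rewrite -val_eqE insubdK.
have proj a b : a != val w -> b != val w -> e a b ->
    insubd d a = insubd d b \/ symmetrized e (val (insubd d a)) (val (insubd d b)).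
  have dx : x != val w -> insubd d x = x1 /\ d = x1.
    move=> xw; split; first by apply: val_inj; rewrite insubdK.
    by rewrite /d -val_eqE eq_sym (negbTE xw).
  move=> aw bw ab.
  case: (boolP (a \in x |: X)) => aW; case: (boolP (b \in x |: X)) => bW.
  - by right; rewrite !insubdK //= ab.
  - have E := leave _ _ aW bW ab; subst a; left.
    by rewrite (outE d b bW); have [-> ->] := dx aw.
  - rewrite (outE d a aW); have [E|E] := enter _ _ aW bW ab; subst b.
      by left; have [-> ->] := dx bw.
    (* An edge entering at [y] turns into the cut edge read backwards if [x] survives, and collapses
       to [y] if [x] is deleted. *)
    rewrite /d; case: (w =P x1) => _; last by right; rewrite insubdK //= yx orbT.
    by left; apply: val_inj; rewrite insubdK.
  - by left; rewrite !outE.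
have := deletion_connected two (x := val u1) (y := val u2) (w := val w).
rewrite !val_eqE => /(_ u1w u2w) cT.
rewrite -(valKd d u1) -(valKd d u2).
apply: (@connect_mono _ _ _ _ (insubd d)) cT => a b /and3P[aw bw].
rewrite /= in aw bw => /orP ab.
have E : insubd d a = insubd d b \/
    symmetrized e (val (insubd d a)) (val (insubd d b)).
  case: ab => [/proj|/proj[]//]; [exact | by move=> -> //; left |].
  by rewrite /= orbC; right.
case: E => [->|E]; first exact: connect0.
by apply: connect1; rewrite /= !pw.
Qed.

(** * Pinched digraphs, and reassembly from the sides *)

Lemma induced_edge_irr (G : digraph) (W : {set G}) :
  irreflexive (relpre (val : {z | z \in W} -> G) edge).
Proof. by move=> z; rewrite /= edge_irr. Qed.

Definition induced (G : digraph) (W : {set G}) : digraph :=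
  Digraph (@induced_edge_irr G W).

Lemma unbreakable3P (G : digraph) :
  unbreakable G /\ three_cyclic G <-> unbreakable3 (@edge G).
Proof.
split=> [[[[_ str] two] cyc]|[str cyc two]]; first by split.
by split=> //; split=> //; split=> //; case: two => c3 _ _; apply: leq_trans c3.
Qed.

(** The 3-ring consists of [v], its outneighbours and its inneighbours. Every edge lies in a
    triangle and every triangle contains [v], which places the ends of each edge in consecutive
    parts. *)
Lemma dominating_vertex_pinched (G : digraph) (v : G) :
  unbreakable3 (@edge G) ->
  (forall a b, a != v -> b != v -> edge a b ->
    ~~ connect (within (predC1 v) edge) b a) ->
  three_pinched G.
Proof.
move=> ub acyc; have [str cyc [c3 _ _]] := ub.
pose A (i : 'I_3) := nth set0 [:: [set v]; [set z | edge v z]; [set z | edge z v]] i.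
have dom (a b c : G) : edge a b -> edge b c -> edge c a -> [|| a == v, b == v | c == v].
  move=> ab bc ca; apply/negPn/negP; rewrite !negb_or => /and3P[av bv cv].
  case/negP: (acyc _ _ av bv ab); apply: (@connect_trans _ _ c); apply: connect1;
    by rewrite /= ?av ?bv ?cv.
have out_edge (u : G) : exists w, edge u w.
  have /card_gt0P[z] : 0 < #|predC1 u|.
    by rewrite cardC1 -subn1 subn_gt0; exact: leq_trans c3.
  rewrite inE => zu; have [] := connect_exit (A := pred1 u) (str u z);
    rewrite ?inE // => a [b [/eqP-> _ ub']].
  by exists b.
have irr (z : G) : edge z z = false by exact: edge_irr.
exists A; last by exists ord0; rewrite /A /= cards1.
split.
- have d12 : [disjoint [set v] & [set z | edge v z]].
    by rewrite disjoints1 inE irr.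
  have d13 : [disjoint [set v] & [set z | edge z v]].
    by rewrite disjoints1 inE irr.
  have d23 : [disjoint [set z | edge v z] & [set z | edge z v]].
    rewrite -setI_eq0; apply/eqP/setP=> z; rewrite !inE; apply/negP=> /andP[vz zv].
    exact: (no_2cycle cyc vz zv).
  by case=> [[|[|[|?]]]] ? [[|[|[|?]]]] ? //; rewrite /A //= disjoint_sym.
- apply/setP=> z; rewrite inE; apply/bigcupP.
  have [b zb] := out_edge z; have [c bc cz] := edge_in_triangle ub zb.
  have /or3P[/eqP E|/eqP E|/eqP E] := dom _ _ _ zb bc cz; subst.
  + by exists (inord 0); rewrite // /A inordK // inE.
  + by exists (inord 2); rewrite // /A inordK // inE.
  + by exists (inord 1); rewrite // /A inordK // inE.
- move=> a b ab; have [c bc ca] := edge_in_triangle ub ab.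
  have /or3P[/eqP E|/eqP E|/eqP E] := dom _ _ _ ab bc ca; subst.
  + by exists (inord 0); rewrite /A /= !inordK //= !inE ab.
  + by exists (inord 2); rewrite /A /= !inordK //= !inE ab.
  + by exists (inord 1); rewrite /A /= !inordK //= !inE ca.
Qed.

(** In the first side [yx] is the only edge into [x], in the second the only edge out of [y], so it
    is special in both. *)
Lemma sum_of_sides (G : digraph) (X : {set G}) (y x : G) :
  unbreakable3 (@edge G) -> one_edge_cut edge X y x ->
  sums_of_three_pinched (induced (x |: X)) ->
  sums_of_three_pinched (induced (y |: ~: X)) ->
  sums_of_three_pinched G.
Proof.
move=> ub cutX s1 s2; have [yX xX yx only _ _] := cutX.
have x1W : x \in x |: X by exact: setU11.
have y1W : y \in x |: X by rewrite setU1r.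
have x2W : x \in y |: ~: X by rewrite setU1r // inE.
have y2W : y \in y |: ~: X by exact: setU11.
pose x1 : induced (x |: X) := Sub x x1W.
pose y1 : induced (x |: X) := Sub y y1W.
pose x2 : induced (y |: ~: X) := Sub x x2W.
pose y2 : induced (y |: ~: X) := Sub y y2W.
have yx1 : edge y1 x1 by [].
have sp1 : special y1 x1.
  split=> //; right; apply/eqP/cards1P; exists y1; apply/setP=> z; rewrite !inE.
  apply/idP/eqP=> [zx|->//]; apply: val_inj => /=.
  have := valP z; rewrite !inE => /orP[/eqP E|zX]; last by case: (only _ _ zX xX zx).
  by move: zx; rewrite /= E edge_irr.
have sp2 : special y2 x2.
  split=> //; left; apply/eqP/cards1P; exists x2; apply/setP=> z; rewrite !inE.
  apply/idP/eqP=> [yz|->//]; apply: val_inj => /=.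
  have := valP z; rewrite !inE => /orP[/eqP E|zX]; last by case: (only _ _ yX zX yz).
  by move: yz; rewrite /= E edge_irr.
apply: (@Sums_iso (edge_sum y2 x2 yx1)); last exact: Sums_edge_sum.
(* The isomorphism sends each vertex of the sum to the vertex it stems from. *)
pose f (p : edge_sum y2 x2 yx1) : G :=
  match p with inl z => val z | inr z => val (val z) end.
have fglue z : f (glue y1 x1 y2 x2 z) = val z.
  rewrite /glue; case: insubP => [s _ <- //|]; rewrite !inE negbK.
  by case: eqP => [->|_ /= /eqP->].
have only_inr (z : {z : induced (y |: ~: X) | z \notin [set y2; x2]}) :
    (val (val z) \notin X) && (val (val z) != x).
  have := valP z; rewrite !inE negb_or -!val_eqE /= => /andP[zy ->].
  by have := valP (val z); rewrite !inE (negbTE zy) andbT.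
have finj : injective f.
  have sep (z : induced (x |: X)) (t : {z : induced (y |: ~: X) | z \notin [set y2; x2]}) :
      val z <> val (val t).
    move=> E; have := valP z; have /andP[tX tx] := only_inr t.
    by rewrite E !inE (negbTE tX) (negbTE tx).
  move=> [p|p] [q|q] /= E.
  - by congr inl; exact: val_inj.
  - by case: (sep p q).
  - by case: (sep q p).
  - by congr inr; do 2 apply: val_inj.
have fsurj z : exists p, f p = z.
  have [zX|zX] := boolP (z \in X).
    have zW : z \in x |: X by rewrite setU1r.
    by exists (inl (Sub z zW)).
  have zW : z \in y |: ~: X by rewrite setU1r // inE.
  by exists (glue y1 x1 y2 x2 (Sub z zW)); rewrite fglue.
exists f.
  apply: inj_card_bij (finj) _; rewrite -(card_codom finj); apply: subset_leq_card.
  by apply/subsetP=> z _; have [p <-] := fsurj z; exact: codom_f.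
have side1 p : f p \in x |: X -> exists2 z, inl z = p & val z = f p.
  by move=> pW; exists (Sub (f p) pW) => //; apply: finj.
have side2 p : f p \in y |: ~: X -> exists2 z, glue y1 x1 y2 x2 z = p & val z = f p.
  by move=> pW; exists (Sub (f p) pW) => //; apply: finj; rewrite fglue.
move=> p q; apply/idP/idP => [pq|]; last first.
  case/orP=> /existsP[a /existsP[b /and3P[ab /eqP <- /eqP <-]]] //.
  by rewrite !fglue.
have in1 : f p \in x |: X -> f q \in x |: X -> edge p q.
  move=> /side1[a Ea Va] /side1[b Eb Vb]; apply/orP; left.
  by apply/existsP; exists a; apply/existsP; exists b; rewrite Ea Eb !eqxx /= Va Vb pq.
have in2 : f p \in y |: ~: X -> f q \in y |: ~: X -> edge p q.
  move=> /side2[a Ea Va] /side2[b Eb Vb]; apply/orP; right.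
  by apply/existsP; exists a; apply/existsP; exists b; rewrite Ea Eb !eqxx /= Va Vb pq.
(* Each edge lies within one side: an edge leaving [X] is [yx], and one entering [X] starts at [x]
   or ends at [y]. *)
have [pX|pX] := boolP (f p \in X); have [qX|qX] := boolP (f q \in X).
- by apply: in1; rewrite setU1r.
- by have [Ep Eq] := only _ _ pX qX pq; apply: in1; rewrite ?Ep ?Eq.
- have [E|E] := cut_entry ub cutX pX qX pq.
    by apply: in1; rewrite ?E // setU1r.
  by apply: in2; rewrite ?E // setU1r // inE.
- by apply: in2; rewrite setU1r // inE.
Qed.

Lemma card_induced (G : digraph) (W : {set G}) b : b \notin W -> #|induced W| < #|G|.
Proof.
move=> bW; rewrite card_sig (eq_card (B := mem W)) // -[#|G|]cardsT.
by apply: proper_card; rewrite properT; apply: contraNneq bW => ->; rewrite inE.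
Qed.

Theorem mainTheorem1 (G : digraph) :
  unbreakable G -> three_cyclic G -> sums_of_three_pinched G.
Proof.
move=> ubG cycG; have ub := (unbreakable3P G).1 (conj ubG cycG) => {ubG cycG}.
(* Induction on the number of vertices; each side omits a vertex. *)
have [n] := ubnP #|G|; elim: n G ub => // n IH G ub; rewrite ltnS => Gn.
have [[X [y [x cutX]]]|[v acyc]] := one_edge_cut_or_dominating_vertex ub; last first.
  exact: Sums_pinched (dominating_vertex_pinched ub acyc).
have [_ _ _ _ [a aX ay] [b bX bx]] := cutX.
apply: (sum_of_sides ub cutX); apply: IH.
- exact: side_unbreakable ub cutX.
- by apply: leq_trans Gn; apply: (@card_induced _ _ b); rewrite !inE negb_or bx.
(* The second side is the first side of the reversed cut, with its edges reversed back. *)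
- exact: unbreakable3_reversed (side_unbreakable (unbreakable3_reversed ub)
    (one_edge_cut_reversed cutX)).
- by apply: leq_trans Gn; apply: (@card_induced _ _ a); rewrite !inE negb_or ay negbK.
Qed.
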